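(* Let $\{e_j\}_{j\geq 0}$ and $\{f_{lj}\}_{l\geq 1,\,j\geq 0}$ be orthonormal bases of Hilbert spaces $\mathcal E$ and $\mathcal F$, respectively, and let $T$ be the bounded operator on $\mathcal E\oplus\mathcal F$ such that $$Tf_{lj}=f_{l,j-1}\ (j\geq 1),\qquad Tf_{l0}=0,\qquad l\geq 1,$$ $$Te_j=e_{j+1}\ \text{ if } j\neq 3^k \text{ for all } k\geq 1,\qquad Te_{3^k}=e_{3^k+1}+f_{l,3^k}\ \text{ for } k\geq 1,\ \text{where } l \text{ is determined by } 2^{l-1}\leq k\leq 2^l-1.$$ Put $\mathcal H_0=\bigvee_{n\geq 0}T^ne_0$ and $T_0=T|_{\mathcal H_0}$. Then $\sigma_e(T_0)=\operatorname{clos}\mathbb D$.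
   Context: Hilbert spaces are complex. $\bigvee$ denotes closed linear span. $\mathbb D$ is the open unit disc. $\sigma_e(A)$ denotes the essential spectrum of an operator $A$ (the set of $\lambda\in\mathbb C$ such that $A-\lambda I$ is not Fredholm). *)

(* Defs.v *)
From HB Require Import structures.
From mathcomp Require Import all_boot all_order all_algebra.
From mathcomp Require Import sesquilinear complex.
From mathcomp Require Import all_classical all_reals.
From mathcomp Require Import topology normedtype.
From mathcomp Require Import ring.

Set Implicit Arguments.
Unset Strict Implicit.
Unset Printing Implicit Defensive.

Import Order.TTheory GRing.Theory Num.Theory.
Import numFieldNormedType.Exports.

Local Open Scope classical_set_scope.
Local Open Scope ring_scope.

(* The inner product is linear in the first argument. *)
HB.mixin Record isHilbert (R : realType) H & CompleteNormedModule R[i] H := {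
  inner : H -> H -> R[i] ;
  innerPl : forall (a : R[i]) (x y z : H),
    inner (a *: x + y) z = a * inner x z + inner y z ;
  innerC : forall x y : H, inner x y = Num.conj (inner y x) ;
  innerxx : forall x : H, inner x x = `|x| ^+ 2
}.

#[short(type="hilbertType")]
HB.structure Definition Hilbert (R : realType) :=
  {H of isHilbert R H & CompleteNormedModule R[i] H}.

Section inner_dot.
Context {R : realType} (H : hilbertType R).
Local Notation dot := (@inner R H).

Let innerP_l (z : H) : GRing.linear_for *%R (dot ^~ z).
Proof. by move=> a x y; rewrite innerPl. Qed.

Let innerP_r (z : H) : GRing.linear_for (Num.conj \; *%R) (dot z).
Proof.
move=> a x y; rewrite innerC innerPl rmorphD rmorphM /=.
by rewrite (innerC z x) (innerC z y).
Qed.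

HB.instance Definition _ := bilinear_isBilinear.Build R[i] H H R[i]
  *%R (Num.conj \; *%R) dot (innerP_l, innerP_r).

Let inner_herm (x y : H) : dot x y = (-1) ^+ false * Num.conj (dot y x).
Proof. by rewrite expr0 mul1r innerC. Qed.

HB.instance Definition _ :=
  isHermitianSesquilinear.Build R[i] H false Num.conj dot inner_herm.

Let inner_gt0 (x : H) : x != 0 -> 0 < dot x x.
Proof. by move=> x0; rewrite innerxx exprn_gt0// normr_gt0. Qed.

HB.instance Definition _ := isDotProduct.Build R[i] H dot inner_gt0.

End inner_dot.

Definition lspan (K : numFieldType) (V : lmodType K) (S : set V) : set V :=
  [set x | exists n (c : 'I_n -> K) (v : 'I_n -> V),
     (forall i, S (v i)) /\ x = \sum_(i < n) c i *: v i].

Definition closed_span (K : numFieldType) (V : normedModType K) (S : set V) :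
  set V := closure (lspan S).

Section lspan_theory.
Context (K : numFieldType) (V : lmodType K) (S : set V).

Lemma sub_lspan : S `<=` lspan S.
Proof.
move=> x Sx; exists 1%N, (fun=> 1), (fun=> x); split => //.
by rewrite big_ord1 scale1r.
Qed.

Lemma lspan0 : lspan S 0.
Proof.
by exists 0%N, (fun=> 0), (fun=> 0); split=> [[]//|]; rewrite big_ord0.
Qed.

Lemma lspanP a x y : lspan S x -> lspan S y -> lspan S (a *: x + y).
Proof.
move=> [n [c [v [Sv ->]]]] [m [d [w [Sw ->]]]].
exists (n + m)%N,
  (fun i => match fintype.split i with inl j => a * c j | inr j => d j end),
  (fun i => match fintype.split i with inl j => v j | inr j => w j end).
split; first by move=> i; case: fintype.splitP.
rewrite big_split_ord/= scaler_sumr; congr (_ + _); apply: eq_bigr => i _.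
  by rewrite (unsplitK (inl _ i)) scalerA.
by rewrite (unsplitK (inr _ i)).
Qed.

End lspan_theory.

Lemma lspan_image (K : numFieldType) (V : lmodType K) (T : {linear V -> V})
    (S : set V) :
  T @` S `<=` S -> T @` lspan S `<=` lspan S.
Proof.
move=> TS _ [_ [n [c [v [Sv ->]]]] <-].
exists n, c, (T \o v); split; first by move=> i; apply: TS; exists (v i).
by rewrite linear_sum; apply: eq_bigr => i _; rewrite linearZ.
Qed.

Lemma closure_normP (K : numFieldType) (V : normedModType K) (A : set V) x :
  closure A x <-> forall e, 0 < e -> exists2 y, A y & `|x - y| < e.
Proof.
split=> [Ax e e0|Ax B].
  have [y [Ay By]] := Ax _ (nbhsx_ballx x e e0).
  by exists y => //; rewrite -ball_normE in By.
move=> /nbhs_ballP[e /= e0 eB]; have [y Ay xy] := Ax _ e0.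
by exists y; split=> //; apply: eB; rewrite -ball_normE.
Qed.

Lemma lipschitz1_cauchy (K : numFieldType) (V W : normedModType K)
    (g : V -> W) (F : set_system V) :
  (forall x y, `|g x - g y| <= `|x - y|) -> ProperFilter F ->
  cauchy F -> cauchy (g @ F).
Proof.
move=> g1 FF /cauchyP Fc; apply/cauchyP => e /Fc[x Fx]; exists (g x).
rewrite /fmap/=; apply: filterS Fx => y; rewrite -!ball_normE/=.
exact/le_lt_trans.
Qed.

(* cspan_type S is the closed linear span of S, as a Hilbert space in its own
   right, with the structure induced by the ambient space. *)
Definition cspan (K : numFieldType) (V : normedModType K) (S : set V) :
  {pred V} := mem (closed_span S).

Section cspan.
Context (K : numFieldType) (V : normedModType K) (S : set V).

Let cspan_submod : submod_closed (cspan S).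
Proof.
split; first by rewrite /cspan inE; apply: subset_closure; exact: lspan0.
move=> a x y; rewrite !inE => /closure_normP xS /closure_normP yS.
apply/closure_normP => e e0.
have a1 : 0 < `|a| + 1 by rewrite ltr_wpDl.
have [u Su xu] := xS (e / 2 / (`|a| + 1)) ltac:(by rewrite !divr_gt0).
have [v Sv yv] := yS (e / 2) ltac:(by rewrite divr_gt0).
exists (a *: u + v); first exact: lspanP.
rewrite opprD addrACA -scalerBr (le_lt_trans (ler_normD _ _))//.
rewrite [ltRHS](splitr e) ler_ltD// normrZ.
rewrite (@le_trans _ _ ((`|a| + 1) * `|x - u|))//.
  by rewrite ler_wpM2r// lerDl.
by rewrite mulrC -ler_pdivlMr// ltW.
Qed.

HB.instance Definition _ := GRing.isSubmodClosed.Build K V (cspan S)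
  cspan_submod.

Definition cspan_type := {x : V | x \in cspan S}.

HB.instance Definition _ := [isSub of cspan_type for @sval V _].
HB.instance Definition _ := [Choice of cspan_type by <:].
HB.instance Definition _ := [SubChoice_isSubLmodule of cspan_type by <:].

Let cnorm (x : cspan_type) : K := `|\val x|.

Let cnormD x y : cnorm (x + y) <= cnorm x + cnorm y.
Proof. by rewrite /cnorm raddfD ler_normD. Qed.

Let cnormZ a x : cnorm (a *: x) = `|a| * cnorm x.
Proof. by rewrite /cnorm linearZ/= normrZ. Qed.

Let cnorm0 x : cnorm x = 0 -> x = 0.
Proof. by move/normr0_eq0 => x0; apply: val_inj; rewrite x0 raddf0. Qed.

HB.instance Definition _ :=
  Lmodule_isNormed.Build K cspan_type cnormD cnormZ cnorm0.

Lemma cspan_normE (x : cspan_type) : `|x| = `|\val x|.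
Proof. by []. Qed.

End cspan.

Section cspan_hilbert.
Context {R : realType} (H : hilbertType R) (S : set H).

Let cspan_complete (F : set_system (cspan_type S)) :
  ProperFilter F -> cauchy F -> cvg F.
Proof.
move=> FF Fc; have : cauchy ((val : cspan_type S -> H) @ F).
  by apply: lipschitz1_cauchy Fc => x y; rewrite -raddfB.
move=> /cauchy_cvg/cvg_ex[l Fl].
have Sl : l \in cspan S.
  rewrite inE; apply: (closed_cvg _ _ _ _ Fl); first exact: closed_closure.
  by apply: nearW => x; have := valP x; rewrite inE.
apply/cvg_ex; exists (exist _ l Sl); apply/fcvgrPdist_lt => e e0.
by have /cvgrPdist_lt/(_ e e0) := Fl; apply: filterS => x.
Qed.

HB.instance Definition _ := Uniform_isComplete.Build (cspan_type S)
  cspan_complete.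

Let cinner (x y : cspan_type S) : R[i] := inner (\val x) (\val y).

Let cinnerPl a x y z : cinner (a *: x + y) z = a * cinner x z + cinner y z.
Proof. by rewrite /cinner linearP/= innerPl. Qed.

Let cinnerC x y : cinner x y = Num.conj (cinner y x).
Proof. exact: innerC. Qed.

Let cinnerxx x : cinner x x = `|x| ^+ 2.
Proof. exact: innerxx. Qed.

HB.instance Definition _ :=
  isHilbert.Build R (cspan_type S) cinnerPl cinnerC cinnerxx.

Lemma cspan_innerE (x y : cspan_type S) : inner x y = inner (\val x) (\val y).
Proof. by []. Qed.

End cspan_hilbert.

(* The Hilbert direct sum is an alias of E * F: the norm of the product type in
   the library is the maximum of the two norms, which is not Hilbertian. *)
Definition hsum (R : realType) (E F : hilbertType R) : Type := (E * F)%type.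

Section hsum.
Context {R : realType} (E F : hilbertType R).

HB.instance Definition _ := GRing.Lmodule.copy (hsum E F) (E * F)%type.

Let snorm (p : hsum E F) : R[i] := sqrtC (`|p.1| ^+ 2 + `|p.2| ^+ 2).

Let snorm_ge0 p : 0 <= snorm p.
Proof. by rewrite sqrtC_ge0 addr_ge0// exprn_ge0. Qed.

Let snorm2 p : snorm p ^+ 2 = `|p.1| ^+ 2 + `|p.2| ^+ 2.
Proof. exact: sqrtCK. Qed.

Let snorm_ge p : `|p.1| <= snorm p /\ `|p.2| <= snorm p.
Proof.
by split; rewrite -(@ler_pXn2r _ 2)// ?nnegrE// snorm2 ?lerDl ?lerDr exprn_ge0.
Qed.

Let snorm_le p : snorm p <= `|p.1| + `|p.2|.
Proof.
rewrite -(@ler_pXn2r _ 2)// ?nnegrE ?addr_ge0// snorm2 sqrrD addrAC lerDl.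
by rewrite mulrn_wge0// mulr_ge0.
Qed.

Let snormD p q : snorm (p + q) <= snorm p + snorm q.
Proof.
have cs (a b c d : R[i]) : 0 <= a -> 0 <= b -> 0 <= c -> 0 <= d ->
    (a * c + b * d) ^+ 2 <= (a ^+ 2 + b ^+ 2) * (c ^+ 2 + d ^+ 2).
  move=> a0 b0 c0 d0; rewrite -subr_ge0.
  rewrite (_ : _ - _ = (a * d - b * c) ^+ 2); last by ring.
  by rewrite real_exprn_even_ge0// rpredB// rpredM// ger0_real.
rewrite -(@ler_pXn2r _ 2)// ?nnegrE ?addr_ge0// snorm2 sqrrD !snorm2.
apply: (@le_trans _ _ ((`|p.1| + `|q.1|) ^+ 2 + (`|p.2| + `|q.2|) ^+ 2)).
  by rewrite lerD// ler_pXn2r ?nnegrE ?addr_ge0// ler_normD.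
have -> : (`|p.1| + `|q.1|) ^+ 2 + (`|p.2| + `|q.2|) ^+ 2 =
  `|p.1| ^+ 2 + `|p.2| ^+ 2 + (`|p.1| * `|q.1| + `|p.2| * `|q.2|) *+ 2 +
  (`|q.1| ^+ 2 + `|q.2| ^+ 2) by ring.
rewrite lerD2r lerD2l lerMn2r/= -(@ler_pXn2r _ 2)//; first last.
- by rewrite nnegrE mulr_ge0.
- by rewrite nnegrE addr_ge0// mulr_ge0.
by rewrite [leRHS]exprMn !snorm2 cs.
Qed.

Let snormZ a p : snorm (a *: p) = `|a| * snorm p.
Proof.
rewrite /snorm !normrZ !exprMn -mulrDr sqrtCM ?nnegrE ?addr_ge0 ?exprn_ge0//.
by rewrite sqrCK.
Qed.

Let snorm0 p : snorm p = 0 -> p = 0.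
Proof.
move/eqP; rewrite sqrtC_eq0 paddr_eq0 ?exprn_ge0// !expf_eq0/= !normr_eq0.
by case: p => x y /= /andP[/eqP-> /eqP->].
Qed.

HB.instance Definition _ :=
  Lmodule_isNormed.Build R[i] (hsum E F) snormD snormZ snorm0.

Let hsum_complete (G : set_system (hsum E F)) :
  ProperFilter G -> cauchy G -> cvg G.
Proof.
move=> GG Gc.
have /cauchy_cvg/cvg_ex[x Gx] : cauchy ((fst : hsum E F -> E) @ G).
  by apply: lipschitz1_cauchy Gc => p q; exact: (snorm_ge (p - q)).1.
have /cauchy_cvg/cvg_ex[y Gy] : cauchy ((snd : hsum E F -> F) @ G).
  by apply: lipschitz1_cauchy Gc => p q; exact: (snorm_ge (p - q)).2.
apply/cvg_ex; exists (x, y); apply/fcvgrPdist_lt => e e0.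
have e2 : 0 < e / 2 by rewrite divr_gt0.
near=> p; rewrite (le_lt_trans (snorm_le ((x, y) - p)))//.
rewrite [ltRHS]splitr ltrD//; near: p.
  by have /cvgrPdist_lt/(_ _ e2) := Gx.
by have /cvgrPdist_lt/(_ _ e2) := Gy.
Unshelve. all: by end_near. Qed.

HB.instance Definition _ := Uniform_isComplete.Build (hsum E F) hsum_complete.

Lemma hsum_normE (p : hsum E F) : `|p| = sqrtC (`|p.1| ^+ 2 + `|p.2| ^+ 2).
Proof. by []. Qed.

Let sinner (p q : hsum E F) : R[i] := inner p.1 q.1 + inner p.2 q.2.

Let sinnerPl a x y z : sinner (a *: x + y) z = a * sinner x z + sinner y z.
Proof. by rewrite /sinner/= !innerPl mulrDr addrACA. Qed.

Let sinnerC x y : sinner x y = Num.conj (sinner y x).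
Proof. by rewrite /sinner rmorphD /= -!innerC. Qed.

Let sinnerxx x : sinner x x = `|x| ^+ 2.
Proof. by rewrite /sinner !innerxx sqrtCK. Qed.

HB.instance Definition _ :=
  isHilbert.Build R (hsum E F) sinnerPl sinnerC sinnerxx.

Lemma hsum_innerE (p q : hsum E F) :
  inner p q = inner p.1 q.1 + inner p.2 q.2.
Proof. by []. Qed.

End hsum.

Definition hsuml (R : realType) (E F : hilbertType R) (x : E) : hsum E F :=
  (x, 0).

Definition hsumr (R : realType) (E F : hilbertType R) (y : F) : hsum E F :=
  (0, y).

Arguments hsuml {R E F}.
Arguments hsumr {R E F}.

(* Only the b i with D i matter: the family is indexed by the set D. *)
Definition orthonormal_basis (R : realType) (H : hilbertType R) (I : eqType)
    (D : set I) (b : I -> H) :=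
  (forall i j, D i -> D j -> inner (b i) (b j) = (i == j)%:R) /\
  closed_span (b @` D) = setT.

(* For a subspace A, being contained in the span of finitely many vectors. *)
Definition fin_dim (K : numFieldType) (V : lmodType K) (A : set V) :=
  exists n (v : 'I_n -> V), A `<=` lspan (range v).

(* For a subspace A, the quotient V / A is finite-dimensional. *)
Definition fin_codim (K : numFieldType) (V : lmodType K) (A : set V) :=
  exists n (v : 'I_n -> V),
    forall x, exists2 a, A a & lspan (range v) (x - a).

(* Intended for bounded operators. *)
Definition fredholm (K : numFieldType) (V W : normedModType K)
    (A : {linear V -> W}) :=
  [/\ fin_dim [set x | A x = 0], closed (range A) & fin_codim (range A)].

Definition essential_spectrum (R : realType) (H : hilbertType R)
    (A : {linear H -> H}) : set R[i] :=
  [set l | ~ fredholm (A \- l \*: idfun : {linear H -> H})].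

Definition forward_orbit (K : numFieldType) (V : lmodType K)
    (T : {linear V -> V}) (x : V) : set V :=
  range (fun n => iter n T x).

Section restriction.
Context (K : numFieldType) (V : normedModType K) (T : {linear V -> V}).

Lemma cspan_forward_orbit_stable (x : V) : bounded_near T (nbhs 0) ->
  {homo T : y / y \in cspan (forward_orbit T x)}.
Proof.
move=> /bounded_linear_continuous cT y; rewrite !inE => yS B.
move=> /cT/yS[z [Sz Bz]]; exists (T z); split => //.
apply: lspan_image; last by exists z.
by move=> _ [_ [n _ <-] <-]; exists n.+1.
Qed.

Context (S : set V) (TS : {homo T : y / y \in cspan S}).

Definition restr (x : cspan_type S) : cspan_type S :=
  exist _ (T (\val x)) (TS (valP x)).

Let restr_linear : linear restr.
Proof. by move=> a x y; apply: val_inj; rewrite /= !linearP. Qed.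

HB.instance Definition _ := GRing.isLinear.Build K _ _ _ restr restr_linear.

End restriction.

Arguments cspan_forward_orbit_stable {K V T} x.

(* Main.v *)
From HB Require Import structures.
Require Import Defs.
From mathcomp Require Import all_boot all_order all_algebra.
From mathcomp Require Import complex.
From mathcomp Require Import all_classical all_reals.
From mathcomp Require Import topology normedtype.
From mathcomp Require Import sesquilinear ring zify.

Set Implicit Arguments.
Unset Strict Implicit.
Unset Printing Implicit Defensive.

Import Order.TTheory GRing.Theory Num.Theory.
Import numFieldNormedType.Exports.

Local Open Scope classical_set_scope.
Local Open Scope ring_scope.

(** Let v n = T ^ n e0 and let H0 be the closed span of the v n. The operator T
    is triangular for the sum of E and F, with the forward shift on E, a sum of
    backward shifts on F, and an off-diagonal term that couples e (3 ^ k) to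
    f l (3 ^ k). The powers of 3 grow so fast that the couplings never overlap:
    v n is e n + f l i if n = 2 * 3 ^ k + 1 - i with i <= 3 ^ k and k >= 1, and
    e n for the other n (orbit_bump, orbit_pow_gap). In particular the orbit is
    bounded.

    If |lam| > 1, both diagonal terms of T - lam are bounded below, hence so is
    T - lam (H0_bounded_below) and T0 - lam is injective with closed range.
    Since lam ^ - N v (n + N) tends to 0, each v n is in the closed range
    (shifted_surjective). So T0 - lam is invertible.

    Let |lam| <= 1. Row l of F is fed by 2 ^ (l - 1) values of k. The sum of the
    corresponding orbit vectors that contain f l i is 2 ^ (l - 1) f l i plus a
    sum of 2 ^ (l - 1) orthonormal vectors of E, whose norm is only
    2 ^ ((l - 1) / 2). So for large l the vectors f l i are almost in H0, and
    with them the truncations of the vector of coordinates lam ^ i in row l,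
    which is a formal eigenvector of the backward shift. Once normalised they
    give vectors x m in H0 with orthonormal F-components and
    |(T0 - lam) (x m)| <= 3 * 2 ^ - m (norm_shifted_approx_eigenvector); this
    holds on the unit circle as well, since the norm of the truncations tends to
    infinity there.

    On the other hand H0 is the graph of an operator from E to F (H0_inner_f),
    so that the coordinates of x in H0 are continuous functions of (T0 - lam) x
    (controlled_e, controlled_f). If the range of T0 - lam were closed, it would
    contain the sum of the (T0 - lam) (x m), and a preimage of it would have all
    the F-coordinates of the divergent sum of the x m, which is impossible
    (closed_range_summation). So T0 - lam is not Fredholm. *)

(** * Inner products and closed spans *)

Section inner_product.
Context {R : realType} {H : hilbertType R}.
Implicit Types x y : H.

Lemma inner_normDsq x y : inner x y = 0 ->
  `|x + y| ^+ 2 = `|x| ^+ 2 + `|y| ^+ 2.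
Proof.
move=> xy; rewrite -!innerxx linearDl !linearDr /= xy.
by rewrite (innerC y x) xy rmorph0 addr0 add0r.
Qed.

Lemma inner_norm_le x y : `|inner x y| <= `|x| * `|y|.
Proof.
have [->|y0] := eqVneq y 0; first by rewrite linear0r /= !normr0 mulr0.
pose a := inner x y / inner y y; have yy : inner y y != 0.
  by rewrite innerxx expf_neq0 ?normr_eq0.
have xa : inner (x - a *: y) (a *: y) = 0.
  by rewrite linearZr_LR /= linearBl linearZl_LR /= divfK // subrr mulr0.
have -> : `|inner x y| = `|a *: y| * `|y|.
  rewrite normrZ -mulrA -expr2 normrM normfV innerxx normrX normr_id.
  by rewrite divfK // expf_neq0 // normr_eq0.
rewrite ler_wpM2r // -(@ler_pXn2r _ 2) ?nnegrE // -[x in leRHS](subrK (a *: y)).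
by rewrite (inner_normDsq xa) lerDr exprn_ge0.
Qed.

Lemma inner_sum (I J : finType) (c : I -> R[i]) (d : J -> R[i])
    (x : I -> H) (y : J -> H) :
  inner (\sum_i c i *: x i) (\sum_j d j *: y j) =
  \sum_i \sum_j c i * Num.conj (d j) * inner (x i) (y j).
Proof.
rewrite linear_sumlz /=; apply: eq_bigr => i _.
rewrite linear_sumr /=; apply: eq_bigr => j _.
by rewrite linearZl_LR linearZr_LR /= mulrA.
Qed.

Lemma norm_sum_orthonormal (I : finType) (c : I -> R[i]) (x : I -> H) :
    (forall i j, inner (x i) (x j) = (i == j)%:R) ->
  `|\sum_i c i *: x i| ^+ 2 = \sum_i `|c i| ^+ 2.
Proof.
move=> xo; rewrite -innerxx inner_sum; apply: eq_bigr => i _.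
rewrite (bigD1 i) //= xo eqxx mulr1 -normCK big1 ?addr0 // => j ji.
by rewrite xo eq_sym (negPf ji) mulr0.
Qed.

End inner_product.

(** The norm of a linear combination is a function of its coefficients and of
    the Gram matrix. The families may have repetitions and live in different
    spaces, as do a family of basis vectors and its image under a shift. *)
Lemma norm_sum_gram (R : realType) (H1 H2 : hilbertType R) (I : finType)
    (c : I -> R[i]) (x : I -> H1) (y : I -> H2) :
    (forall i j, inner (x i) (x j) = inner (y i) (y j)) ->
  `|\sum_i c i *: x i| = `|\sum_i c i *: y i|.
Proof.
move=> xy; apply/eqP; rewrite -(@eqrXn2 _ 2) // -!innerxx !inner_sum.
by apply/eqP; apply: eq_bigr => i _; apply: eq_bigr => j _; rewrite xy.
Qed.

Section closed_span_extension.
Context (K : numFieldType) (V W1 W2 : normedModType K) (S : set V).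

(** Bounded maps are uniformly continuous, so an inequality between the norms
    of their values passes from the algebraic span to its closure. *)
Lemma closed_span_norm_le (f : V -> W1) (g : V -> W2) M :
    linear f -> linear g ->
    (forall x, `|f x| <= M * `|x|) -> (forall x, `|g x| <= M * `|x|) ->
    (forall x, lspan S x -> `|f x| <= `|g x|) ->
  forall x, closed_span S x -> `|f x| <= `|g x|.
Proof.
move=> fl gl fM gM fg x /closure_normP xS.
pose fL := GRing.isLinear.Build K V W1 _ f fl.
pose gL := GRing.isLinear.Build K V W2 _ g gl.
pose F : {linear V -> W1} := HB.pack f fL.
pose G : {linear V -> W2} := HB.pack g gL.
have f0 : f 0 = 0 := linear0 F.
have fD u w : f (u + w) = f u + f w := linearD F u w.
have gD u w : g (u + w) = g u + g w := linearD G u w.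
have [x0|x0] := eqVneq x 0.
  by rewrite x0 f0 normr0 normr_ge0.
have M0 : 0 <= M.
  by rewrite -(@pmulr_lge0 _ `|x|) ?normr_gt0 // (le_trans _ (fM x)).
apply/ler_addgt0Pr => e e0.
have [y Sy xy] := xS (e / 2 / (M + 1)) ltac:(by rewrite !divr_gt0 // ltr_wpDl).
have Me : M * `|x - y| <= e / 2.
  rewrite (@le_trans _ _ ((M + 1) * `|x - y|)) ?ler_wpM2r ?lerDl //.
  by rewrite mulrC -ler_pdivlMr ?ltW // ltr_wpDl.
have fxy : `|f x| <= e / 2 + `|f y|.
  rewrite -{1}(subrK y x) fD (le_trans (ler_normD _ _)) // lerD2r.
  exact: le_trans (fM _) Me.
have gxy : `|g y| <= e / 2 + `|g x|.
  rewrite -{1}(subrK x y) gD (le_trans (ler_normD _ _)) // lerD2r.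
  by rewrite (le_trans (gM _)) // distrC.
have -> : `|g x| + e = e / 2 + (e / 2 + `|g x|).
  by rewrite addrA -splitr addrC.
by rewrite (le_trans fxy) // lerD2l (le_trans (fg _ Sy)).
Qed.

End closed_span_extension.

Lemma closed_span_eq0 (K : numFieldType) (V W : normedModType K) (S : set V)
    (f : V -> W) M :
    linear f -> (forall x, `|f x| <= M * `|x|) ->
    (forall x, S x -> f x = 0) ->
  forall x, closed_span S x -> f x = 0.
Proof.
move=> fl fM fS x Sx.
pose fL := GRing.isLinear.Build K V W _ f fl.
pose F : {linear V -> W} := HB.pack f fL.
have [->|x0] := eqVneq x 0; first exact: (linear0 F).
have M0 : 0 <= M.
  by rewrite -(@pmulr_lge0 _ `|x|) ?normr_gt0 // (le_trans _ (fM x)).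
apply/eqP; rewrite -normr_le0 -(@normr0 _ W).
apply: (@closed_span_norm_le K V W W S f (fun=> 0) M) Sx => // [|y|y].
- by move=> a u w; rewrite scaler0 addr0.
- by rewrite normr0 mulr_ge0.
move=> [n [c [v [Sv ->]]]].
have -> : f (\sum_i c i *: v i) = \sum_i F (c i *: v i) := linear_sum F _ _ _.
by rewrite big1 ?normr0 // => i _; rewrite linearZ /= fS ?scaler0.
Qed.

(** * Operators with closed range *)

Lemma exists_natr_gt (R : realType) (x : R[i]) : x \is Num.real ->
  exists n : nat, x < n%:R.
Proof.
move=> /complex_realP[k ->]; exists (Num.bound `|k|).
rewrite -(rmorph_nat (real_complex R)) ltcR.
exact: le_lt_trans (ler_norm k) (archi_boundP (normr_ge0 k)).
Qed.

Lemma exists_exprVn_lt (R : realType) (r e : R[i]) : 1 < r -> 0 < e ->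
  exists n : nat, r ^- n < e.
Proof.
move=> r1 e0; have r0 : 0 < r - 1 by rewrite subr_gt0.
have [n ne] : exists n : nat, (e * (r - 1))^-1 < n%:R.
  by apply: exists_natr_gt; rewrite gtr0_real // invr_gt0 mulr_gt0.
exists n; have bernoulli : n%:R * (r - 1) < r ^+ n.
  elim: (n) => [|k IH]; first by rewrite mul0r expr0.
  rewrite -natr1 mulrDl mul1r.
  have -> : r ^+ k.+1 = r ^+ k + (r - 1) * r ^+ k by rewrite exprS; ring.
  by rewrite ltr_leD // ler_peMr ?(ltW r0) // exprn_ege1 ?ltW.
rewrite -[ltRHS]invrK ltf_pV2 ?posrE ?exprn_gt0 ?invr_gt0 ?(lt_trans _ r1) //.
apply: lt_trans bernoulli.
by rewrite -ltr_pdivrMr // -invfM.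
Qed.

(** A limit of values A x is attained: the points whose values are close to
    the limit form a Cauchy filter, since their distance is controlled by that
    of their values. *)
Lemma closed_range_bounded_below (K : numFieldType)
    (V : completeNormedModType K) (W : normedModType K)
    (A : {linear V -> W}) (C : K) :
    continuous A -> (forall x, `|x| <= C * `|A x|) -> closed (range A).
Proof.
move=> cA AC z /closure_normP zA.
pose F := filter_from [set e : K | 0 < e] (fun e => [set x | `|z - A x| < e]).
have FF : ProperFilter F.
  apply: filter_from_proper => [|e e0]; last first.
    by have [_ [x _ <-] xe] := zA e e0; exists x.
  apply: filter_from_filter; first by exists 1 => /=.
  move=> d e /= d0 e0.
  have de : (d >=< e)%O by rewrite real_comparable ?gtr0_real.
  exists (Num.min d e); first by rewrite /= comparable_lt_min ?d0.
  by move=> x /=; rewrite comparable_lt_min // => /andP.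
have Fc : cauchy F.
  apply/cauchyP => e e0; pose d := e / 2 / (`|C| + 1).
  have C1 : 0 < `|C| + 1 by rewrite ltr_wpDl.
  have d0 : 0 < d by rewrite !divr_gt0.
  have [_ [x _ <-] xd] := zA d d0; exists x; exists d => //= y yd.
  rewrite -ball_normE /=; have [->|xy] := eqVneq x y.
    by rewrite subrr normr0.
  have Axy : `|A (x - y)| < 2 * d.
    rewrite linearB -(subrKA z) (le_lt_trans (ler_normD _ _)) //.
    by rewrite mulr_natl mulr2n ltrD // distrC.
  have C0 : 0 <= C.
    have := le_trans (normr_ge0 _) (AC (x - y)).
    rewrite pmulr_lge0 // lt_def normr_ge0 andbT normr_eq0; apply/eqP => Axy0.
    have := AC (x - y); rewrite Axy0 normr0 mulr0 normr_le0 subr_eq0.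
    by rewrite (negPf xy).
  rewrite (le_lt_trans (AC _)) //.
  rewrite (@le_lt_trans _ _ ((`|C| + 1) * `|A (x - y)|)) //.
    by rewrite ler_wpM2r // (ger0_norm C0) lerDl.
  rewrite mulrC -ltr_pdivlMr // (lt_le_trans Axy) //.
  by rewrite /d mulrA [2 * _]mulrC divfK // pnatr_eq0.
have /cvg_ex[l Fl] : cvg F by exact: cauchy_cvg.
exists l => //; apply/eqP; rewrite eq_sym -subr_eq0 -normr_le0.
apply/ler_addgt0Pr => e e0; rewrite add0r.
have e2 : 0 < e / 2 by rewrite divr_gt0.
have /cvgrPdist_lt /(_ _ e2) Al : A x @[x --> F] --> A l.
  by apply: cvg_trans (cA l); exact: cvg_app.
near F => x.
rewrite -(subrKA (A x)) [leRHS]splitr (le_trans (ler_normD _ _)) //.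
rewrite lerD // ltW //.
  by near: x; exists (e / 2).
by rewrite distrC; near: x.
Unshelve. all: by end_near. Qed.

(** The images A (x n) form a convergent series, whose sum is a value A v if
    the range is closed. The functionals phi m are dominated by A, so they
    cannot tell v from the partial sums of the x n, although those need not
    converge. If the phi m are coordinates for an orthonormal family, no v has
    phi m v = 1 for all m, and the range is not closed. *)
Lemma closed_range_summation (R : realType) (V : lmodType R[i])
    (W : completeNormedModType R[i]) (A : {linear V -> W})
    (phi : nat -> V -> R[i]) (x : nat -> V) (C : R[i]) :
    (forall m, scalar (phi m)) -> closed (range A) ->
    (forall m, exists2 c, 0 <= c & forall v, `|phi m v| <= c * `|A v|) ->
    (forall m n, phi m (x n) = (m == n)%:R) ->
    (forall n, `|A (x n)| <= C * 2 ^- n) ->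
  exists v, forall m, phi m v = 1.
Proof.
move=> phil Acl phiA phix xC.
pose phiL m := GRing.isLinear.Build _ _ _ _ (phi m) (phil m).
pose Phi m : {scalar V} := HB.pack (phi m) (phiL m).
pose s n := \sum_(i < n) x i.
have C0 : 0 <= C.
  by have := le_trans (normr_ge0 _) (xC 0%N); rewrite expr0 invr1 mulr1.
have sC M k : `|A (s (M + k)%N) - A (s M)| <= 2 * C * (2 ^- M - 2 ^- (M + k)).
  elim: k => [|k IH]; first by rewrite addn0 !subrr normr0 mulr0.
  rewrite -linearB addnS /s big_ord_recr /= addrAC linearD.
  rewrite (le_trans (ler_normD _ _)) // linearB (le_trans (lerD IH (xC _))) //.
  rewrite le_eqVlt; apply/orP; left; apply/eqP.
  have -> : 2 ^- (M + k).+1 = 2^-1 * 2 ^- (M + k) :> R[i].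
    by rewrite exprS invfM.
  by move: (2 ^- M) (2 ^- (M + k)) => p q; field.
have sC' M k : `|A (s M) - A (s (M + k)%N)| <= 2 * C * 2 ^- M.
  rewrite distrC (le_trans (sC M k)) // ler_wpM2l ?mulr_ge0 //.
  by rewrite lerBlDr lerDl invr_ge0 exprn_ge0.
have sF e : 0 < e -> exists M, forall n, (M <= n)%N -> `|A (s M) - A (s n)| < e.
  move=> e0; have C1 : 0 < 2 * C + 1 by rewrite ltr_wpDl ?mulr_ge0.
  have [||M Me] := @exists_exprVn_lt R 2 (e / (2 * C + 1)).
  - by rewrite ltr1n.
  - by rewrite divr_gt0.
  exists M => n /subnKC <-; rewrite (le_lt_trans (sC' _ _)) //.
  rewrite (@le_lt_trans _ _ ((2 * C + 1) * 2 ^- M)) //.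
    by rewrite ler_wpM2r ?lerDl // invr_ge0 exprn_ge0.
  by rewrite mulrC -ltr_pdivlMr.
have : cauchy ((A \o s) n @[n --> \oo]).
  apply/cauchyP => e e0; have [M Me] := sF e e0.
  exists (A (s M)); exists M => //= n /= Mn; rewrite -ball_normE; exact: Me.
move=> /cauchy_cvg /cvg_ex [z sz].
have [v _ Av] : range A z.
  apply: Acl => B Bz; have [N _ NB] := sz _ Bz.
  by exists (A (s N)); split; [exists (s N)|exact: (NB N (leqnn N))].
exists v => m; have [c c0 mc] := phiA m.
apply/eqP; rewrite -subr_eq0 -normr_le0; apply/ler_addgt0Pr => e e0.
rewrite add0r; have c1 : 0 < c + 1 by rewrite ltr_wpDl.
have /cvgrPdist_lt /(_ (e / (c + 1)) ltac:(by rewrite divr_gt0)) [N _ Ns] := sz.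
pose n := (N + m.+1)%N; have nm : (m < n)%N by rewrite /n addnS ltnS leq_addl.
have <- : phi m (s n) = 1.
  rewrite -[phi m]/(Phi m : _ -> _) linear_sum (bigD1 (Ordinal nm)) //=.
  rewrite phix eqxx big1 ?addr0 // => i im.
  by rewrite phix; case: eqP => // mi; rewrite -val_eqE /= -mi eqxx in im.
rewrite -(linearB (Phi m)) (le_trans (mc _)) // linearB Av.
rewrite (@le_trans _ _ ((c + 1) * `|z - A (s n)|)) ?ler_wpM2r ?lerDl //.
rewrite mulrC -ler_pdivlMr // ltW //; apply: Ns; exact: leq_addr.
Qed.

(** If A - lam were Fredholm its range would be closed, and the vector v of
    closed_range_summation would exist. *)
Lemma essential_spectrum_summation (R : realType) (H : hilbertType R)
    (A : {linear H -> H}) (lam : R[i])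
    (phi : nat -> H -> R[i]) (x : nat -> H) (C : R[i]) :
    (forall m, scalar (phi m)) ->
    (forall m, exists2 c, 0 <= c &
      forall v, `|phi m v| <= c * `|A v - lam *: v|) ->
    (forall m n, phi m (x n) = (m == n)%:R) ->
    (forall n, `|A (x n) - lam *: x n| <= C * 2 ^- n) ->
    (forall v, ~ forall m, phi m v = 1) ->
  essential_spectrum A lam.
Proof.
move=> phil phiA phix xC nv [_ Acl _].
by have [v /nv] := closed_range_summation phil Acl phiA phix xC.
Qed.

(** By the lower bound A - lam is injective with closed range, so that
    surjectivity has to be proved for a closed range only. The kernel and the
    cokernel are then trivial. *)
Lemma not_essential_spectrum (R : realType) (H : hilbertType R)
    (A : {linear H -> H}) (lam : R[i]) (C : R[i]) :
    continuous A ->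
    (forall x, `|x| <= C * `|A x - lam *: x|) ->
    (closed (range (fun x => A x - lam *: x)) ->
      forall y, range (fun x => A x - lam *: x) y) ->
  ~ essential_spectrum A lam.
Proof.
move=> cA below surj; apply; set B := (A \- lam \*: idfun : {linear H -> H}).
have cB : continuous B.
  move=> x; apply: cvgB; first exact: cA.
  exact: scaler_continuous.
have Bcl : closed (range B) by apply: closed_range_bounded_below cB below.
split=> //.
  exists 0, (fun=> 0) => x Bx; have := below x; rewrite -[_ - _]/(B x) [B x]Bx.
  rewrite normr0 mulr0 normr_le0 => /eqP ->; exact: lspan0.
exists 0, (fun=> 0) => x; exists x; last by rewrite subrr; exact: lspan0.
exact: (surj Bcl).
Qed.

Lemma closed_span_inner_eq0 (R : realType) (H : hilbertType R) (S : set H)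
    (w : H) :
    (forall x, S x -> inner x w = 0) ->
  forall x, closed_span S x -> inner x w = 0.
Proof.
apply: (@closed_span_eq0 _ _ (R[i]^o : normedModType R[i]) _
  (fun x => inner x w : R[i]^o) `|w|).
- by move=> a x y; rewrite innerPl.
- by move=> x; rewrite mulrC inner_norm_le.
Qed.

(** * The direct sum *)

Section hsum_theory.
Context {R : realType} (E F : hilbertType R).
Implicit Types p : hsum E F.

Lemma hsum_normsq p : `|p| ^+ 2 = `|p.1| ^+ 2 + `|p.2| ^+ 2.
Proof. by rewrite hsum_normE sqrtCK. Qed.

Lemma hsum_norm_fst p : `|p.1| <= `|p|.
Proof. by rewrite -(@ler_pXn2r _ 2) ?nnegrE // hsum_normsq lerDl exprn_ge0. Qed.

Lemma hsum_norm_snd p : `|p.2| <= `|p|.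
Proof. by rewrite -(@ler_pXn2r _ 2) ?nnegrE // hsum_normsq lerDr exprn_ge0. Qed.

Lemma norm_hsuml (x : E) : `|hsuml x : hsum E F| = `|x|.
Proof. by rewrite hsum_normE /= normr0 expr0n addr0 sqrCK. Qed.

Lemma norm_hsumr (y : F) : `|hsumr y : hsum E F| = `|y|.
Proof. by rewrite hsum_normE /= normr0 expr0n add0r sqrCK. Qed.

Lemma hsum_split p : p = hsuml p.1 + hsumr p.2.
Proof. by case: p => x y; congr pair; rewrite /= ?addr0 ?add0r. Qed.

Lemma hsum_norm_le p : `|p| <= `|p.1| + `|p.2|.
Proof.
rewrite {1}(hsum_split p) (le_trans (ler_normD _ _)) //.
by rewrite norm_hsuml norm_hsumr.
Qed.

Lemma hsumr_linear : linear (@hsumr R E F).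
Proof. by move=> a x y; congr pair; rewrite /= scaler0 addr0. Qed.

HB.instance Definition _ :=
  GRing.isLinear.Build R[i] F (hsum E F) _ (@hsumr R E F) hsumr_linear.

Lemma inner_hsuml p (x : E) : inner p (hsuml x) = inner p.1 x.
Proof. by rewrite hsum_innerE /= linear0r addr0. Qed.

Lemma inner_hsumr p (y : F) : inner p (hsumr y) = inner p.2 y.
Proof. by rewrite hsum_innerE /= linear0r add0r. Qed.

Lemma hsum_sum_fst (I : Type) (r : seq I) (P : pred I) (u : I -> hsum E F) :
  (\sum_(i <- r | P i) u i).1 = \sum_(i <- r | P i) (u i).1.
Proof. by elim/big_rec2: _ => // i x p _ <-. Qed.

Lemma hsum_sum_snd (I : Type) (r : seq I) (P : pred I) (u : I -> hsum E F) :
  (\sum_(i <- r | P i) u i).2 = \sum_(i <- r | P i) (u i).2.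
Proof. by elim/big_rec2: _ => // i x p _ <-. Qed.

End hsum_theory.

(** * The combinatorics of the exponents *)

Section bumps.
Local Open Scope nat_scope.

(** The step that follows time 3 ^ k gives the orbit a component at position
    3 ^ k of a row of F, and each later step lowers its position by 1:
    bump_index k i is the time at which it is at position i. *)
Definition bump_index k i := 2 * 3 ^ k + 1 - i.

Lemma bump_index_bounds k i : i <= 3 ^ k ->
  3 ^ k < bump_index k i <= 2 * 3 ^ k + 1.
Proof. by rewrite /bump_index; move: (3 ^ k) => p; lia. Qed.

(** The intervals of times attached to distinct k are disjoint, because
    2 * 3 ^ k + 1 <= 3 ^ k.+1 for k >= 1. *)
Lemma bump_index_inj k k' i i' :
    0 < k -> 0 < k' -> i <= 3 ^ k -> i' <= 3 ^ k' ->
  bump_index k i = bump_index k' i' -> k = k' /\ i = i'.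
Proof.
have lt a b j j' : 0 < a -> a < b -> j <= 3 ^ a -> j' <= 3 ^ b ->
    bump_index a j = bump_index b j' -> False.
  move=> a0 ab ja jb; have := bump_index_bounds ja.
  have := bump_index_bounds jb.
  have : 3 * 3 ^ a <= 3 ^ b by rewrite -expnS leq_exp2l.
  have : 3 ^ 1 <= 3 ^ a by rewrite leq_exp2l.
  by move: (3 ^ a) (3 ^ b) (bump_index a j) (bump_index b j') => *; lia.
move=> k0 k'0 ik i'k' e.
have [kk|kk|kk] := ltngtP k k'.
- by case: (lt _ _ _ _ k0 kk ik i'k' e).
- by case: (lt _ _ _ _ k'0 kk i'k' ik (esym e)).
split=> //; move: kk ik i'k' e => <-; rewrite /bump_index.
by move: (3 ^ k) => p; lia.
Qed.

Lemma bump_or_gap n : 3 < n ->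
  exists2 k, 0 < k & (exists2 i, i <= 3 ^ k & n = bump_index k i) \/
                     2 * 3 ^ k + 1 < n <= 3 ^ k.+1.
Proof.
move=> n3; have n0 : 0 < n.-1 by lia.
have /andP[] := trunc_log_bounds (isT : 1 < 3) n0.
set k := trunc_log 3 n.-1 => kn nk; exists k.
  by rewrite trunc_log_gt0 /=; lia.
have [le|gt] := leqP n (2 * 3 ^ k + 1); [left|right].
  exists (2 * 3 ^ k + 1 - n); rewrite ?/bump_index; last by lia.
  by move: kn; move: (3 ^ k) => p; lia.
by move: nk; move: (3 ^ k.+1) => p; lia.
Qed.

(** The l such that 2 ^ (l - 1) <= k <= 2 ^ l - 1. *)
Definition bump_row k := (trunc_log 2 k).+1.

Lemma bump_row_bounds k : 0 < k ->
  2 ^ (bump_row k - 1) <= k <= 2 ^ bump_row k - 1.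
Proof.
move=> k0; rewrite /bump_row subn1 /=.
have /andP[-> /=] := trunc_log_bounds (isT : 1 < 2) k0.
by move: (2 ^ _) => p; lia.
Qed.

Lemma bump_rowP k l : 0 < k -> 0 < l ->
  (bump_row k == l) = (2 ^ (l - 1) <= k < 2 ^ (l - 1) + 2 ^ (l - 1)).
Proof.
move=> k0; case: l => // l _.
rewrite /bump_row eqSS subn1 /= addnn -mul2n -expnS.
apply/eqP/idP => [<-|]; first exact: trunc_log_bounds.
exact: trunc_log_eq.
Qed.

End bumps.

(** * The orbit of the first basis vector *)

Section foguel_orbit.
Context {R : realType} {E F : hilbertType R}.
Context (e : nat -> E) (f : nat -> nat -> F).
Context (he : orthonormal_basis setT e).
Context (hf : orthonormal_basis [set p : nat * nat | (1 <= p.1)%N]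
            (fun p : nat * nat => f p.1 p.2)).
Context (T : {linear hsum E F -> hsum E F}).
Context (hT : bounded_near T (nbhs 0)).
Context (hTf : forall l j : nat, (1 <= l)%N -> (1 <= j)%N ->
       T (hsumr (f l j)) = hsumr (f l (j - 1)%N)).
Context (hTf0 : forall l : nat, (1 <= l)%N -> T (hsumr (f l 0%N)) = 0).
Context (hTe : forall j : nat, (forall k : nat, (1 <= k)%N -> j <> (3 ^ k)%N) ->
       T (hsuml (e j)) = hsuml (e (j + 1)%N)).
Context (hTe3 : forall k l : nat, (1 <= k)%N -> (1 <= l)%N ->
       (2 ^ (l - 1) <= k <= 2 ^ l - 1)%N ->
       T (hsuml (e (3 ^ k)%N)) =
         hsuml (e (3 ^ k + 1)%N) + hsumr (f l (3 ^ k)%N)).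

Let orbit n : hsum E F := iter n T (hsuml (e 0)).
Let H0 : set (hsum E F) := closed_span (forward_orbit T (hsuml (e 0))).

Lemma inner_basis_e i j : inner (e i) (e j) = (i == j)%:R.
Proof. by case: he => + _; apply. Qed.

Lemma inner_basis_f l i l' i' : (0 < l)%N -> (0 < l')%N ->
  inner (f l i) (f l' i') = ((l == l') && (i == i'))%:R.
Proof.
move=> l0 l'0; case: hf => + _ => /(_ (l, i) (l', i')) /= ->//.
Qed.

Lemma T_bound : exists2 M : R[i], 0 < M & forall x, `|T x| <= M * `|x|.
Proof.
by have /linear_boundedP/pinfty_ex_gt0[M M0 TM] := hT; exists M.
Qed.

Lemma T_e_gap k j : (3 ^ k < j < 3 ^ k.+1)%N ->
  T (hsuml (e j)) = hsuml (e j.+1).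
Proof.
move=> /andP[kj jk]; rewrite -(addn1 j); apply: hTe => k' _ jk'; move: kj jk.
by rewrite jk' !ltn_exp2l // => kk'; rewrite ltnS leqNgt kk'.
Qed.

Lemma T_e_pow k : (0 < k)%N ->
  T (hsuml (e (3 ^ k)%N)) =
    hsuml (e (3 ^ k).+1) + hsumr (f (bump_row k) (3 ^ k)%N).
Proof.
move=> k0; rewrite -(addn1 (3 ^ k)); apply: hTe3 => //.
exact: bump_row_bounds.
Qed.

Lemma orbit_small n : (n <= 3)%N -> orbit n = hsuml (e n).
Proof.
elim: n => // n IH n3; rewrite /orbit iterS -/(orbit n) IH 1?ltnW //.
rewrite -(addn1 n); apply: hTe => k k0 nk; move: n3; rewrite nk ltnNge.
by rewrite -{1}[3%N]expn1 leq_exp2l ?k0.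
Qed.

(** After time 3 ^ k, each step moves the component in E forward and the one in
    F backward. The value at time 3 ^ k is a hypothesis here and in
    orbit_pow_gap; orbit_pow proves it by induction on k, since
    orbit_pow_gap reaches time 3 ^ k.+1. *)
Lemma orbit_pow_bump k i : (0 < k)%N -> (i <= 3 ^ k)%N ->
    orbit (3 ^ k) = hsuml (e (3 ^ k)%N) ->
  orbit (bump_index k i) =
    hsuml (e (bump_index k i)) + hsumr (f (bump_row k) i).
Proof.
move=> k0 ik ok; have k3 : (3 ^ k.+1 = 3 * 3 ^ k)%N by rewrite expnS.
rewrite -{1 2 3}(subKn ik); move: (3 ^ k - i)%N (leq_subr i (3 ^ k)) => d.
elim: d => [|d IH] dk.
  have -> : bump_index k (3 ^ k - 0) = (3 ^ k).+1.
    by rewrite /bump_index; move: (3 ^ k)%N => p; lia.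
  by rewrite /orbit iterS -/(orbit _) ok T_e_pow // subn0.
have -> : bump_index k (3 ^ k - d.+1) = (bump_index k (3 ^ k - d)).+1.
  by move: dk; rewrite /bump_index; move: (3 ^ k)%N => p; lia.
rewrite {1}/orbit iterS -/(orbit _) IH 1?ltnW // linearD.
rewrite (@T_e_gap k) ?hTf ?subn_gt0 //; first by rewrite -subnDA addn1.
move: dk; rewrite k3 /bump_index; move: (3 ^ k)%N => p; lia.
Qed.

(** After position 0 the component in F is killed, and none is created before
    time 3 ^ k.+1. *)
Lemma orbit_pow_gap k n : (0 < k)%N -> (2 * 3 ^ k + 1 < n <= 3 ^ k.+1)%N ->
    orbit (3 ^ k) = hsuml (e (3 ^ k)%N) -> orbit n = hsuml (e n).
Proof.
move=> k0 nk ok; have k3 : (3 ^ k.+1 = 3 * 3 ^ k)%N by rewrite expnS.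
have -> : (n = 2 * 3 ^ k + 2 + (n - (2 * 3 ^ k + 2)))%N.
  by move: nk; move: (3 ^ k)%N (3 ^ k.+1)%N => p q; lia.
have : (2 * 3 ^ k + 2 + (n - (2 * 3 ^ k + 2)) <= 3 ^ k.+1)%N.
  by move: nk; move: (3 ^ k)%N (3 ^ k.+1)%N => p q; lia.
elim: (n - _)%N => [|d IH] dk.
  have -> : (2 * 3 ^ k + 2 + 0 = (bump_index k 0).+1)%N.
    by rewrite /bump_index; move: (3 ^ k)%N => p; lia.
  rewrite {1}/orbit iterS -/(orbit _) orbit_pow_bump // linearD hTf0 // addr0.
  rewrite (@T_e_gap k) //; move: dk; rewrite k3 /bump_index.
  by move: (3 ^ k)%N => p; lia.
rewrite addnS {1}/orbit iterS -/(orbit _) IH; last first.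
  by move: dk; rewrite addnS; exact: ltnW.
rewrite (@T_e_gap k) //; move: dk.
by move: (3 ^ k)%N (3 ^ k.+1)%N => p q; lia.
Qed.

Lemma orbit_pow k : (0 < k)%N -> orbit (3 ^ k) = hsuml (e (3 ^ k)%N).
Proof.
case: k => // k _; elim: k => [|k IH]; first exact: orbit_small.
apply: (@orbit_pow_gap k.+1) => //; rewrite [X in (_ < X)%N]expnS leqnn andbT.
have : (3 ^ 1 <= 3 ^ k.+1)%N by rewrite leq_exp2l.
by move: (3 ^ k.+1)%N => p; lia.
Qed.

Lemma orbit_bump k i : (0 < k)%N -> (i <= 3 ^ k)%N ->
  orbit (bump_index k i) =
    hsuml (e (bump_index k i)) + hsumr (f (bump_row k) i).
Proof. by move=> k0 ik; apply: orbit_pow_bump => //; exact: orbit_pow. Qed.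

Lemma orbit_after_bump k : (0 < k)%N ->
  orbit (bump_index k 0).+1 = hsuml (e (bump_index k 0).+1).
Proof.
move=> k0; apply: (@orbit_pow_gap k) => //; last exact: orbit_pow.
have : (3 ^ 1 <= 3 ^ k)%N by rewrite leq_exp2l.
by rewrite [(3 ^ k.+1)%N]expnS /bump_index; move: (3 ^ k)%N => p; lia.
Qed.

Lemma orbit_cases n :
  (exists k i, [/\ (0 < k)%N, (i <= 3 ^ k)%N & n = bump_index k i]) \/
  (orbit n = hsuml (e n) /\
   forall k i, (0 < k)%N -> (i <= 3 ^ k)%N -> n <> bump_index k i).
Proof.
have [n3|n3] := leqP n 3.
  right; split=> [|k i k0 ik nk]; first exact: orbit_small.
  have /andP[+ _] := bump_index_bounds ik; rewrite -nk.
  have : (3 ^ 1 <= 3 ^ k)%N by rewrite leq_exp2l.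
  by move: n3; move: (3 ^ k)%N => p; lia.
have [k k0 [[i ik ->]|gap]] := bump_or_gap n3; first by left; exists k, i.
have [[k' [i [k'0 ik' nk']]]|] :=
  pselect (exists k i, [/\ (0 < k)%N, (i <= 3 ^ k)%N & n = bump_index k i]).
  by left; exists k', i.
move=> nbump; right; split=> [|k' i k'0 ik' nk'].
  by apply: (@orbit_pow_gap k) => //; exact: orbit_pow.
by apply: nbump; exists k', i.
Qed.

Lemma orbit_fst n : (orbit n).1 = e n.
Proof.
have [[k [i [k0 ik ->]]]|[-> _]//] := orbit_cases n.
by rewrite orbit_bump //= addr0.
Qed.

Lemma norm_orbit_le n : `|orbit n| <= 2.
Proof.
have ne i : `|e i| = 1.
  by apply/eqP; rewrite -(@eqrXn2 _ 2) // expr1n -innerxx inner_basis_e eqxx.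
have nf l i : (0 < l)%N -> `|f l i| = 1.
  move=> l0; apply/eqP; rewrite -(@eqrXn2 _ 2) // expr1n -innerxx.
  by rewrite inner_basis_f // !eqxx.
have [[k [i [k0 ik ->]]]|[-> _]] := orbit_cases n.
  rewrite orbit_bump // (le_trans (ler_normD _ _)) // norm_hsuml norm_hsumr.
  by rewrite ne nf.
by rewrite norm_hsuml ne ler1n.
Qed.

(** * Linear relations on the cyclic subspace *)

Lemma orbit_in n : orbit n \in cspan (forward_orbit T (hsuml (e 0))).
Proof. by rewrite inE; apply/subset_closure/sub_lspan; exists n. Qed.

(** The component in E of the orbit is the orthonormal sequence e, so that T
    acts on the E-coordinates of the cyclic subspace as the forward shift. *)
Lemma H0_inner_T_e0 x : H0 x -> inner (T x) (hsuml (e 0)) = 0.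
Proof.
have [M M0 TM] := T_bound; move: x.
apply: (@closed_span_eq0 _ _ (R[i]^o : normedModType R[i]) _
  (fun x => inner (T x) (hsuml (e 0)) : R[i]^o)
  (M * `|hsuml (e 0) : hsum E F|)).
- by move=> a x y; rewrite linearP innerPl.
- move=> x; rewrite (le_trans (inner_norm_le _ _)) //.
  by rewrite mulrAC ler_wpM2r ?TM.
move=> _ [n _ <-]; rewrite -[T _]/(orbit n.+1) inner_hsuml orbit_fst.
by rewrite inner_basis_e.
Qed.

Lemma H0_inner_T_eS x j : H0 x ->
  inner (T x) (hsuml (e j.+1)) = inner x (hsuml (e j)).
Proof.
have [M M0 TM] := T_bound; move=> H0x; apply/eqP; rewrite -subr_eq0; apply/eqP.
move: x H0x.
apply: (@closed_span_eq0 _ _ (R[i]^o : normedModType R[i]) _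
  (fun x => inner (T x) (hsuml (e j.+1)) - inner x (hsuml (e j)) : R[i]^o)
  (M * `|hsuml (e j.+1) : hsum E F| + `|hsuml (e j) : hsum E F|)).
- move=> a x y; rewrite linearP !innerPl.
  by rewrite -[a *: _]/(a * _) mulrBr opprD addrACA.
- move=> x; rewrite (le_trans (ler_normB _ _)) // mulrDl lerD //.
    by rewrite (le_trans (inner_norm_le _ _)) // mulrAC ler_wpM2r ?TM.
  by rewrite (le_trans (inner_norm_le _ _)) // mulrC.
move=> _ [n _ <-]; rewrite -[T _]/(orbit n.+1) !inner_hsuml orbit_fst.
by rewrite -/(orbit n) orbit_fst !inner_basis_e eqSS subrr.
Qed.

(** The cyclic subspace is the graph of an operator from E to F: each
    F-coordinate is a finite sum of E-coordinates. Row l is fed by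
    2 ^ (l - 1) values of k, and the bound on i says that all of them reach
    position i. *)
Lemma H0_inner_f x l i : (0 < l)%N -> (i <= 3 ^ (2 ^ (l - 1)))%N -> H0 x ->
  inner x (hsumr (f l i)) =
  \sum_(r < 2 ^ (l - 1)) inner x (hsuml (e (bump_index (2 ^ (l - 1) + r) i))).
Proof.
set K := (2 ^ (l - 1))%N => l0 iK H0x.
have K0 : (0 < K)%N by rewrite expn_gt0.
apply/eqP; rewrite -subr_eq0 -linear_sumr -linearBr; apply/eqP; move: x H0x.
apply: closed_span_inner_eq0 => _ [n _ <-].
rewrite -/(orbit n) linearBr linear_sumr /=.
rewrite (eq_bigr (fun r : 'I_K => (n == bump_index (K + r) i)%:R)); last first.
  by move=> r _; rewrite inner_hsuml orbit_fst inner_basis_e.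
have Kr0 r : (0 < K + r)%N by rewrite addn_gt0 K0.
have iKr r : (i <= 3 ^ (K + r))%N.
  by rewrite (leq_trans iK) // leq_exp2l // leq_addr.
have [[k [i' [k0 i'k ->]]]|[-> nbump]] := orbit_cases n; last first.
  rewrite inner_hsumr linear0l /= big1 ?subrr // => r _.
  by case: eqP => // /nbump; case.
rewrite orbit_bump // inner_hsumr /= add0r inner_basis_f // bump_rowP //.
have [[r kr]|nr] :=
    pselect (exists r : 'I_K, bump_index k i' = bump_index (K + r) i).
  have [kKr ->] := bump_index_inj k0 (Kr0 r) i'k (iKr r) kr.
  rewrite kKr leq_addr ltn_add2l ltn_ord eqxx (bigD1 r) //= eqxx.
  rewrite big1 ?addr0 ?subrr // => s sr; case: eqP => // rs.
  have [/addnI rs' _] := bump_index_inj (Kr0 r) (Kr0 s) (iKr r) (iKr s) rs.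
  by move: sr; rewrite -val_eqE /= rs' eqxx.
rewrite [X in _ - X]big1 ?subr0 => [|r _]; last first.
  by case: eqP => // kr; case: nr; exists r.
case: andP => // -[/andP[Kk kK] /eqP ii']; case: nr.
have kK' : (k - K < K)%N by rewrite ltn_subLR.
by exists (Ordinal kK'); rewrite /= subnKC // ii'.
Qed.

(** * Outside the closed disc: lower bounds *)

Lemma H0_norm_fst_T x : H0 x -> `|(T x).1| <= `|x.1|.
Proof.
have [M M0 TM] := T_bound; move: x.
apply: (@closed_span_norm_le _ _ _ _ _ (fun x => (T x).1)
  (fun x : hsum E F => x.1) (M + 1)).
- by move=> a x y; rewrite linearP.
- by [].
- move=> x; rewrite (le_trans (hsum_norm_fst _)) // (le_trans (TM _)) //.
  by rewrite ler_wpM2r // lerDl.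
- move=> x; rewrite (le_trans (hsum_norm_fst _)) //.
  by rewrite ler_peMl // lerDr ltW.
move=> _ [n [c [v [Sv ->]]]].
have /choice[p vp] i : exists k, orbit k = v i.
  by have [k _ <-] := Sv i; exists k.
rewrite linear_sum !hsum_sum_fst le_eqVlt; apply/orP; left; apply/eqP.
rewrite (eq_bigr (fun i => c i *: e (p i).+1)); last first.
  by move=> i _; rewrite linearZ /= -vp -[T _]/(orbit (p i).+1) orbit_fst.
rewrite [in RHS](eq_bigr (fun i => c i *: e (p i))); last first.
  by move=> i _; rewrite /= -vp orbit_fst.
by apply: norm_sum_gram => i j; rewrite !inner_basis_e eqSS.
Qed.

Lemma fst_T_hsumr y : (T (hsumr y)).1 = 0.
Proof.
have [M M0 TM] := T_bound.
have : closed_span [set f p.1 p.2 | p in [set p : nat * nat | (1 <= p.1)%N]] y.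
  by case: hf => _ ->.
move: y; apply: (@closed_span_eq0 _ _ _ _ (fun y => (T (hsumr y)).1) M).
- by move=> a x y; rewrite !linearP.
- move=> y; rewrite (le_trans (hsum_norm_fst _)) //.
  by rewrite -(norm_hsumr E y) TM.
move=> _ [[l [|j]] /= l0 <-]; first by rewrite hTf0.
by rewrite hTf.
Qed.

(** T is a backward shift on F. Splitting a combination of basis vectors into
    the part at position 0, which T kills, and the rest, which T maps
    isometrically, leaves a Pythagorean inequality. *)
Lemma norm_T_hsumr y : `|T (hsumr y)| <= `|y|.
Proof.
have [M M0 TM] := T_bound.
have : closed_span [set f p.1 p.2 | p in [set p : nat * nat | (1 <= p.1)%N]] y.
  by case: hf => _ ->.
move: y; apply: (@closed_span_norm_le _ _ _ _ _ (fun y => T (hsumr y))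
  (fun y => y) (M + 1)).
- by move=> a x y; rewrite !linearP.
- by [].
- move=> y; rewrite (le_trans (TM _)) // norm_hsumr.
  by rewrite ler_wpM2r // lerDl.
- by move=> y; rewrite ler_peMl // lerDr ltW.
move=> _ [n [c [v [Sv ->]]]].
have /choice[p vp] i : exists q : nat * nat, (0 < q.1)%N /\ f q.1 q.2 = v i.
  by have [q q0 <-] := Sv i; exists q.
pose a i : F := if (p i).2 == 0%N then f (p i).1 (p i).2 else 0.
pose b i : F := if (p i).2 == 0%N then 0 else f (p i).1 (p i).2.
have vab i : v i = a i + b i.
  by rewrite /a /b; case: (vp i) => _ <-; case: ifP; rewrite ?addr0 ?add0r.
have -> : `|T (hsumr (\sum_i c i *: v i))| = `|\sum_i c i *: b i|.
  have -> : T (hsumr (\sum_i c i *: v i)) = \sum_i c i *: T (hsumr (v i)).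
    by rewrite !linear_sum; apply: eq_bigr => i _; rewrite !linearZ.
  apply: norm_sum_gram => i j; case: (vp i) => /= l0 <-; case: (vp j) => l'0 <-.
  rewrite /b; case: (p i) l0 => l [|k] /= l0;
    case: (p j) l'0 => l' [|k'] /= l'0.
  - by rewrite hTf0 // linear0l linear0l.
  - by rewrite hTf0 // linear0l linear0l.
  - by rewrite hTf0 // linear0r linear0r.
  by rewrite !hTf // inner_hsumr /= !inner_basis_f // !subn1 eqSS.
have -> : \sum_i c i *: v i = \sum_i c i *: a i + \sum_i c i *: b i.
  by rewrite -big_split; apply: eq_bigr => i _; rewrite vab scalerDr.
rewrite -(@ler_pXn2r _ 2) ?nnegrE // inner_normDsq ?lerDr ?exprn_ge0 //.
rewrite inner_sum big1 // => i _; rewrite big1 // => j _.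
case: (vp i) (vp j) => /= l0 _ [l'0 _]; rewrite /a /b.
case: eqP => [p0|_]; last by rewrite linear0l mulr0.
case: eqP => [_|p1]; first by rewrite linear0r mulr0.
rewrite inner_basis_f // p0.
have -> : (0%N == (p j).2) = false by apply/eqP => pj; apply: p1.
by rewrite andbF mulr0.
Qed.

(** T - lam is triangular for the sum of E and F. Its diagonal terms are
    contractions minus lam, hence bounded below by |lam| - 1, and the
    off-diagonal term is bounded. *)
Lemma H0_bounded_below lam : 1 < `|lam| ->
  exists C, forall x, H0 x -> `|x| <= C * `|T x - lam *: x|.
Proof.
move=> lam1; have [M M0 TM] := T_bound.
pose d := `|lam| - 1; have d0 : 0 < d by rewrite subr_gt0.
exists (d^-1 + d^-1 * (1 + M * d^-1)) => x H0x.
set z := T x - lam *: x.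
have d1 : `|x.1| <= d^-1 * `|z|.
  rewrite mulrC ler_pdivlMr // mulrC mulrBl mul1r lerBlDr -normrZ.
  have -> : lam *: x.1 = (T x).1 - z.1.
    by rewrite /z /= opprB addrC subrK.
  rewrite (le_trans (ler_normB _ _)) // addrC.
  by rewrite lerD ?hsum_norm_fst ?H0_norm_fst_T.
have d2 : `|x.2| <= d^-1 * (`|z| + M * `|x.1|).
  rewrite mulrC ler_pdivlMr // mulrC mulrBl mul1r lerBlDr -normrZ.
  have -> : lam *: x.2 = (T (hsuml x.1)).2 + (T (hsumr x.2)).2 - z.2.
    rewrite -[(T _).2 + _]/((T _ + T _).2) -linearD -hsum_split.
    by rewrite /z /= opprB addrC subrK.
  rewrite (le_trans (ler_normB _ _)) // addrC -addrA lerD ?hsum_norm_snd //.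
  rewrite (le_trans (ler_normD _ _)) // lerD //.
    by rewrite (le_trans (hsum_norm_snd _)) // -(norm_hsuml F x.1) TM.
  by rewrite (le_trans (hsum_norm_snd _)) // norm_T_hsumr.
rewrite (le_trans (hsum_norm_le _)) // mulrDl lerD // (le_trans d2) //.
rewrite -mulrA ler_wpM2l ?invr_ge0 ?(ltW d0) // mulrDl mul1r lerD2l -mulrA.
by rewrite ler_wpM2l // ltW.
Qed.

(** * Inside the closed disc: approximate eigenvectors *)

Section shifted_operator.
Context (lam : R[i]).
Local Notation A x := (T x - lam *: x).

(** A functional is controlled when it factors continuously through T - lam on
    the cyclic subspace. *)
Definition controlled (w : hsum E F) :=
  exists2 c, 0 <= c & forall x, H0 x -> `|inner x w| <= c * `|A x|.

Lemma controlled_sum n (c : 'I_n -> R[i]) (w : 'I_n -> hsum E F) :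
  (forall i, controlled (w i)) -> controlled (\sum_(i < n) c i *: w i).
Proof.
move=> cw; apply: (big_ind controlled) => [|u v [a a0 au] [b b0 bv]|i _].
- by exists 0 => // x _; rewrite linear0r /= normr0 mul0r.
- exists (a + b) => [|x H0x]; first exact: addr_ge0.
  by rewrite linearDr mulrDl (le_trans (ler_normD _ _)) // lerD ?au ?bv.
have [a a0 aw] := cw i; exists (`|c i| * a) => [|x H0x]; first exact: mulr_ge0.
by rewrite linearZr_LR /= normrM norm_conjC -mulrA ler_wpM2l ?aw.
Qed.

(** The coordinates of (T - lam) x are those of x shifted, minus lam times those
    of x. This determines the latter one after the other, starting from 0, or
    directly by a shift if lam = 0. *)
Lemma controlled_e j : controlled (hsuml (e j)).
Proof.
have ne i x : `|inner x (hsuml (e i))| <= `|x : hsum E F|.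
  rewrite (le_trans (inner_norm_le _ _)) // norm_hsuml.
  suff -> : `|e i| = 1 by rewrite mulr1.
  by apply/eqP; rewrite -(@eqrXn2 _ 2) // expr1n -innerxx inner_basis_e eqxx.
have [lam0|lam0] := eqVneq lam 0.
  exists 1 => // x H0x; rewrite lam0 scale0r subr0 mul1r.
  by rewrite -H0_inner_T_eS // ne.
elim: j => [|j [c c0 IH]].
  exists `|lam|^-1 => [|x H0x]; first by rewrite invr_ge0.
  rewrite mulrC ler_pdivlMr ?normr_gt0 // mulrC -normrM.
  have -> : lam * inner x (hsuml (e 0)) = - inner (A x) (hsuml (e 0)).
    by rewrite linearBl /= H0_inner_T_e0 // linearZl_LR sub0r opprK.
  by rewrite normrN ne.
exists (`|lam|^-1 * (c + 1)) => [|x H0x].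
  by rewrite mulr_ge0 ?invr_ge0 // addr_ge0.
rewrite -mulrA mulrC ler_pdivlMr ?normr_gt0 // mulrC -normrM.
have -> : lam * inner x (hsuml (e j.+1)) =
    inner x (hsuml (e j)) - inner (A x) (hsuml (e j.+1)).
  rewrite [in X in _ - X]linearBl /= H0_inner_T_eS // linearZl_LR.
  by rewrite opprB addrC subrK.
by rewrite (le_trans (ler_normB _ _)) // mulrDl mul1r lerD ?ne ?IH.
Qed.

(** F-coordinates are finite sums of E-coordinates on the cyclic subspace. *)
Lemma controlled_f l i : (0 < l)%N -> (i <= 3 ^ (2 ^ (l - 1)))%N ->
  controlled (hsumr (f l i)).
Proof.
move=> l0 il.
have [c c0 cw] := @controlled_sum _ (fun=> 1) _
  (fun r : 'I_(2 ^ (l - 1)) => controlled_e (bump_index (2 ^ (l - 1) + r) i)).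
exists c => // x H0x; rewrite H0_inner_f // (le_trans _ (cw x H0x)) //.
rewrite linear_sumr /= le_eqVlt; apply/orP; left; apply/eqP; congr `| _ |.
by apply: eq_bigr => r _; rewrite scale1r.
Qed.

Section bump_combinations.
Context (K : nat) (K0 : (0 < K)%N).

(** The orbit at the times when the components in F started by the K values
    k = K, ..., 2 * K - 1 are at position i, where i <= 3 ^ K. If
    K = 2 ^ (l - 1) these components are all f l i and add up to K times it,
    whereas the components in E are orthonormal and add up to a vector of norm
    sqrt K only. So bump_sum i / K approximates f l i. *)
Definition bump_sum i := \sum_(r < K) orbit (bump_index (K + r) i).

(** Without the errors in E, this is K times a truncation of the series of the
    lam ^ i f l i, an eigenvector of the backward shift of row l when it
    converges. *)
Definition bump_comb N := \sum_(i < N) lam ^+ i *: bump_sum i.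

Let Kr0 r : (0 < K + r)%N. Proof. by rewrite addn_gt0 K0. Qed.
Let iKr i r : (i <= 3 ^ K)%N -> (i <= 3 ^ (K + r))%N.
Proof. by move/leq_trans; apply; rewrite leq_exp2l // leq_addr. Qed.

Lemma T_bump_sumS i : (i < 3 ^ K)%N -> T (bump_sum i.+1) = bump_sum i.
Proof.
move=> iK; rewrite linear_sum; apply: eq_bigr => r _.
rewrite -[LHS]/(orbit (bump_index (K + r) i.+1).+1); congr orbit.
have : (i < 3 ^ (K + r))%N by exact: (@iKr i.+1).
by rewrite /bump_index; move: (3 ^ _)%N => p; lia.
Qed.

(** The sum telescopes as it does for a geometric eigenvector of a backward
    shift. *)
Lemma shifted_bump_comb N : (N < 3 ^ K)%N ->
  A (bump_comb N.+1) = T (bump_sum 0) - lam ^+ N.+1 *: bump_sum N.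
Proof.
elim: N => [|N IH] NK.
  by rewrite /bump_comb big_ord1 expr0 scale1r expr1.
rewrite /bump_comb big_ord_recr /= linearD linearZ /= T_bump_sumS 1?ltnW //.
rewrite scalerDr opprD addrACA IH 1?ltnW // scalerA -exprS.
by rewrite addrA subrK.
Qed.

Lemma norm_T_bump_sum0 : `|T (bump_sum 0)| ^+ 2 = K%:R.
Proof.
have -> : T (bump_sum 0) =
    \sum_(r < K) 1 *: hsuml (e (bump_index (K + r) 0).+1).
  rewrite linear_sum; apply: eq_bigr => r _; rewrite scale1r.
  by rewrite -orbit_after_bump.
rewrite norm_sum_orthonormal => [|r s]; last first.
  rewrite inner_hsuml inner_basis_e eqSS; congr (nat_of_bool _)%:R.
  apply/eqP/eqP => [rs|->//]; apply/val_inj.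
  by case: (bump_index_inj (Kr0 r) (Kr0 s) (leq0n _) (leq0n _) rs) => /addnI.
rewrite (eq_bigr (fun=> 1)) ?sumr_const ?card_ord // => r _.
by rewrite normr1 expr1n.
Qed.

Lemma norm_bump_sum_le i : `|bump_sum i| <= 2 * K%:R.
Proof.
rewrite (le_trans (ler_norm_sum _ _ _)) //.
rewrite (@le_trans _ _ (\sum_(r < K) 2)) ?ler_sum // => [r _|].
  exact: norm_orbit_le.
by rewrite sumr_const card_ord mulr_natr.
Qed.

Lemma bump_comb_snd l N : (0 < l)%N -> K = (2 ^ (l - 1))%N ->
    (N <= (3 ^ K).+1)%N ->
  (bump_comb N).2 = K%:R *: \sum_(i < N) lam ^+ i *: f l i.
Proof.
move=> l0 Kl NK; rewrite hsum_sum_snd scaler_sumr; apply: eq_bigr => i _.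
rewrite /= scalerA mulrC -scalerA; congr (_ *: _).
rewrite hsum_sum_snd (eq_bigr (fun=> f l i)) => [|r _]; last first.
  have iK : (i <= 3 ^ K)%N by rewrite -ltnS (leq_trans (ltn_ord i)).
  rewrite (orbit_bump (Kr0 r) (iKr r iK)) [LHS]add0r.
  have -> // : bump_row (K + r) = l.
  by apply/eqP; rewrite bump_rowP // -Kl leq_addr ltn_add2l ltn_ord.
by rewrite sumr_const card_ord scaler_nat.
Qed.

Lemma bump_comb_in N : bump_comb N \in cspan (forward_orbit T (hsuml (e 0))).
Proof.
apply: rpred_sum => i _; apply/rpredZ/rpred_sum => r _.
exact: orbit_in.
Qed.

End bump_combinations.

Section unit_disc_point.
Context (lam1 : `|lam| <= 1) (m : nat).
Let l := m.*2.+1.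
Let K := (2 ^ m.*2)%N.

(** The truncation length and the number of orbit vectors that are added are
    both K = 4 ^ m, which makes both error terms of the order of 2 ^ - m. *)
Definition row_vec : F := \sum_(i < K) lam ^+ i *: f l i.

(** The term for i = 0 of the sum of squares is 1. As |lam| <= 1, all its
    K = 4 ^ m terms are at least |lam| ^ (2 * K). *)
Lemma norm_row_vec_ge :
  1 <= `|row_vec| /\ 2 ^+ m * `|lam| ^+ K <= `|row_vec|.
Proof.
have gK : `|row_vec| ^+ 2 = \sum_(i < K) `|lam ^+ i| ^+ 2.
  by apply: norm_sum_orthonormal => i j; rewrite inner_basis_f // eqxx.
have K0 : (0 < K)%N by rewrite expn_gt0.
split; rewrite -(@ler_pXn2r _ 2) ?nnegrE ?mulr_ge0 ?exprn_ge0 // gK.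
  rewrite (bigD1 (Ordinal K0)) //= expr0 normr1 lerDl.
  by apply: sumr_ge0 => i _; exact: exprn_ge0.
have -> : (2 ^+ m * `|lam| ^+ K) ^+ 2 = \sum_(i < K) (`|lam| ^+ K) ^+ 2.
  rewrite exprMn sumr_const card_ord -[RHS]mulr_natl; congr (_ * _).
  by rewrite /K natrX -exprM muln2.
apply: ler_sum => i _; rewrite normrX ler_pXn2r ?nnegrE ?exprn_ge0 //.
by apply: ler_wiXn2l; rewrite // ltnW.
Qed.

Definition approx_eigenvector : hsum E F :=
  (K%:R * `|row_vec|)^-1 *: bump_comb K K.

Definition unit_row : F := `|row_vec|^-1 *: row_vec.

Let row0 : `|row_vec| != 0.
Proof. by rewrite gt_eqF // (lt_le_trans ltr01) //; case: norm_row_vec_ge. Qed.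

Let K0 : (0 < K)%N. Proof. by rewrite expn_gt0. Qed.

Lemma approx_eigenvector_snd : approx_eigenvector.2 = unit_row.
Proof.
rewrite /approx_eigenvector /= (@bump_comb_snd _ K0 l) //.
- by rewrite scalerA invfM mulrAC mulVf ?mul1r // pnatr_eq0 -lt0n.
- by rewrite /l subn1.
by rewrite ltnW // ltnS ltnW // ltn_expl.
Qed.

Lemma approx_eigenvector_in :
  approx_eigenvector \in cspan (forward_orbit T (hsuml (e 0))).
Proof. by apply/rpredZ/bump_comb_in. Qed.

(** After telescoping two terms are left, to be divided by K |row_vec|. The
    vector T (bump_sum 0) is a sum of K orthonormal vectors, of norm
    sqrt K = 2 ^ m. The other term is at most |lam| ^ K (2 * K), and
    2 ^ m |lam| ^ K <= |row_vec|. *)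
Lemma norm_shifted_approx_eigenvector : `|A approx_eigenvector| <= 3 * 2 ^- m.
Proof.
have [g1 g2] := norm_row_vec_ge; rewrite /approx_eigenvector.
move: `|row_vec| g1 g2 => g g1 g2.
have g0 : 0 < g by rewrite (lt_le_trans ltr01).
have KK : K%:R = 2 ^+ m * 2 ^+ m :> R[i].
  by rewrite /K natrX -exprD addnn.
have p0 : 0 < 2 ^+ m :> R[i] by rewrite exprn_gt0.
have nT : `|T (bump_sum K 0)| = 2 ^+ m.
  apply/eqP; rewrite -(@eqrXn2 _ 2) ?(ltW p0) // norm_T_bump_sum0 //.
  by rewrite KK expr2.
have AK : `|A (bump_comb K K)| <= 2 ^+ m + `|lam| ^+ K * (2 * K%:R).
  have pK : (K.-1 < 3 ^ K)%N by rewrite prednK // ltnW // ltn_expl.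
  have := shifted_bump_comb K0 pK; rewrite prednK // => ->.
  rewrite (le_trans (ler_normB _ _)) // nT lerD2l.
  by rewrite normrZ normrX ler_wpM2l ?exprn_ge0 // norm_bump_sum_le.
rewrite linearZ /= [lam *: _]scalerA [lam * _]mulrC -scalerA -scalerBr.
rewrite normrZ ger0_norm ?invr_ge0 ?mulr_ge0 ?ler0n ?(ltW g0) //.
rewrite mulrC ler_pdivrMr ?mulr_gt0 ?ltr0n // (le_trans AK) //.
have -> : 3 * 2 ^- m * (K%:R * g) = 2 ^+ m * g + 2 * (2 ^+ m * g).
  by rewrite KK; move: (2 ^+ m) p0 => p p0; field; rewrite gt_eqF.
rewrite lerD ?ler_peMr ?(ltW p0) // mulrCA ler_wpM2l // KK.
by rewrite mulrA mulrC ler_wpM2l ?(ltW p0) // mulrC.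
Qed.

Lemma controlled_unit_row : controlled (hsumr unit_row).
Proof.
have -> : hsumr unit_row =
    \sum_(i < K) (`|row_vec|^-1 * lam ^+ i) *: hsumr (f l i) :> hsum E F.
  rewrite /unit_row {2}/row_vec scaler_sumr linear_sum.
  by apply: eq_bigr => i _; rewrite scalerA linearZ.
apply: controlled_sum => i; apply: controlled_f => //.
rewrite /l subn1 /= -/K (leq_trans (ltnW (ltn_ord i))) //.
by rewrite ltnW // ltn_expl.
Qed.

End unit_disc_point.

Lemma inner_unit_row m n : `|lam| <= 1 ->
  inner (unit_row m) (unit_row n) = (m == n)%:R.
Proof.
move=> lam1; rewrite linearZl_LR linearZr_LR /=.
have [<-|mn] := eqVneq m n; last first.
  rewrite linear_sumlz big1 ?mul0r ?mulr0 // => i _.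
  rewrite linear_sumr big1 // => j _.
  rewrite linearZl_LR linearZr_LR /= inner_basis_f //.
  have -> : (m.*2.+1 == n.*2.+1) = false.
    by rewrite eqSS -!muln2 eqn_mul2r /= (negPf mn).
  by rewrite !mulr0.
have [g1 _] := norm_row_vec_ge lam1 m.
have g0 : `|row_vec m| != 0 by rewrite gt_eqF // (lt_le_trans ltr01).
rewrite innerxx geC0_conj ?invr_ge0 // mulrA -expr2 exprVn.
by rewrite mulVf // expf_neq0.
Qed.

End shifted_operator.

Local Notation HT := (cspan_type (forward_orbit T (hsuml (e 0)))).
Local Notation T0 :=
  (restr (cspan_forward_orbit_stable (hsuml (e 0)) hT) : {linear HT -> HT}).

(** The F-components of the approximate eigenvectors are the orthonormal
    vectors unit_row lam m. If the range of T0 - lam were closed, some vector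
    would have inner product 1 with all of them. *)
Lemma disc_sub_essential_spectrum lam : `|lam| <= 1 ->
  essential_spectrum T0 lam.
Proof.
move=> lam1.
pose x m : HT := exist (fun x => x \in cspan _) _ (approx_eigenvector_in lam m).
apply: (@essential_spectrum_summation R HT T0 lam
  (fun m v => inner (\val v) (hsumr (unit_row lam m))) x 3).
- by move=> m a u v; exact: innerPl.
- move=> m; have [c c0 cw] := controlled_unit_row lam m; exists c => // v.
  by apply: cw; have := valP v; rewrite inE.
- move=> m n; rewrite /= inner_hsumr approx_eigenvector_snd //.
  by rewrite inner_unit_row // eq_sym.
- by move=> n; exact: norm_shifted_approx_eigenvector.
move=> v v1.
(* M is too large for the Cauchy-Schwarz inequality between v and the sum w of
   the first M rows. *)
have [M Mv] := exists_natr_gt (ger0_real (exprn_ge0 2 (normr_ge0 (\val v)))).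
pose w : hsum E F := hsumr (\sum_(i < M) 1 *: unit_row lam i).
have ww : `|w| ^+ 2 = M%:R.
  rewrite norm_hsumr norm_sum_orthonormal => [|i j].
    rewrite (eq_bigr (fun=> 1)) ?sumr_const ?card_ord // => i _.
    by rewrite normr1 expr1n.
  by rewrite inner_unit_row.
have vw : inner (\val v) w = M%:R.
  rewrite /w linear_sum linear_sumr (eq_bigr (fun=> 1)) => [|i _].
    by rewrite sumr_const card_ord.
  by rewrite /= scale1r v1.
have := inner_norm_le (\val v) w; rewrite vw normr_nat.
rewrite -(@ler_pXn2r _ 2) ?nnegrE ?mulr_ge0 // exprMn ww expr2.
have [M0|M0] := posnP M.
  by move: Mv; rewrite M0 => /lt_geF; rewrite exprn_ge0.
by rewrite ler_pM2r ?ltr0n // => /le_gtF; rewrite Mv.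
Qed.

(** * Outside the closed disc: surjectivity *)

(** The range contains T ^ n e0 - lam ^ - N T ^ (n + N) e0 for all N, by
    telescoping. The orbit is bounded, so that the last term tends to 0 and the
    orbit is in the range if that is closed. *)
Lemma shifted_surjective lam : 1 < `|lam| ->
    closed (range (fun x : HT => T0 x - lam *: x)) ->
  forall y, range (fun x : HT => T0 x - lam *: x) y.
Proof.
set A := fun x : HT => T0 x - lam *: x; move=> lam1 Acl.
have lam0 : lam != 0 by rewrite -normr_gt0 (lt_trans ltr01).
have A0 : A 0 = 0 by rewrite /A linear0 scaler0 subrr.
have rangeP a x y : range A x -> range A y -> range A (a *: x + y).
  move=> [u _ <-] [v _ <-]; exists (a *: u + v) => //.
  by rewrite /A linearP scalerDr opprD addrACA scalerBr !scalerA mulrC.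
pose orb n : HT :=
  exist (fun x => x \in cspan _) (orbit n) (orbit_in n).
have tail n N : range A (orb n - lam ^- N *: orb (n + N)%N).
  elim: N => [|N IH].
    by exists 0; rewrite // A0 addn0 expr0 invr1 scale1r subrr.
  have AN : A (orb (n + N)%N) = orb (n + N.+1)%N - lam *: orb (n + N)%N.
    by apply: val_inj; rewrite /= addnS.
  have -> : orb n - lam ^- N.+1 *: orb (n + N.+1)%N =
      - lam ^- N.+1 *: A (orb (n + N)%N) + (orb n - lam ^- N *: orb (n + N)%N).
    have lamS : lam ^- N.+1 * lam = lam ^- N.
      by rewrite exprS invfM mulrAC mulVf // mul1r.
    rewrite AN scalerBr !scaleNr opprK scalerA lamS.
    by rewrite addrACA subrr addr0 addrC.
  by apply: rangeP => //; exists (orb (n + N)%N).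
have orbA n : range A (orb n).
  apply: Acl; apply/closure_normP => d d0.
  have [N Nd] := exists_exprVn_lt lam1 (divr_gt0 d0 (ltr0Sn _ 1)).
  exists (orb n - lam ^- N *: orb (n + N)%N); first exact: tail.
  rewrite opprB addrC subrK normrZ normfV normrX.
  rewrite (@le_lt_trans _ _ (`|lam| ^- N * 2)) -?ltr_pdivlMr //.
  by rewrite ler_wpM2l ?invr_ge0 ?exprn_ge0 // cspan_normE norm_orbit_le.
move=> x; apply: Acl; apply/closure_normP => d d0.
have /closure_normP : closed_span (forward_orbit T (hsuml (e 0))) (\val x).
  by have := valP x; rewrite inE.
move=> /(_ d d0)[_ [n [c [v [Sv ->]]]] xd].
have /choice[p vp] i : exists k, orbit k = v i.
  by have [k _ <-] := Sv i; exists k.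
exists (\sum_i c i *: orb (p i)).
  elim/big_ind: _ => [|u w uA wA|i _]; first by exists 0; rewrite ?A0.
    by rewrite -[u]scale1r; exact: rangeP.
  by rewrite -[_ *: _]addr0; apply: rangeP => //; exists 0; rewrite ?A0.
rewrite cspan_normE raddfB raddf_sum /=.
rewrite (eq_bigr (fun i => c i *: v i)) // => i _.
by rewrite -vp.
Qed.

Lemma essential_spectrum_sub_disc lam : 1 < `|lam| ->
  ~ essential_spectrum T0 lam.
Proof.
move=> lam1; have [C HC] := H0_bounded_below lam1.
apply: (@not_essential_spectrum R HT T0 lam C).
- apply: bounded_linear_continuous; apply/linear_boundedP.
  have [M M0 TM] := T_bound; near=> r => x.
  rewrite (@le_trans _ _ (M * `|x|)) ?ler_wpM2r //; first exact: TM.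
  by near: r; apply: nbhs_pinfty_ge; rewrite gtr0_real.
- by move=> x; apply: HC; have := valP x; rewrite inE.
exact: shifted_surjective.
Unshelve. all: by end_near. Qed.

End foguel_orbit.

(** * The essential spectrum *)

Lemma closure_unit_disc (R : realType) :
  closure [set z : R[i]^o | `|z| < 1] = [set z : R[i]^o | `|z| <= 1].
Proof.
apply/seteqP; split=> z /= => [/closure_normP zd|z1].
  apply/ler_addgt0Pr => d d0; have [y /= y1 zy] := zd d d0.
  rewrite -(subrK y z) addrC (le_trans (ler_normD _ _)) // addrC.
  by rewrite addrC lerD // ltW.
apply/closure_normP => d d0; pose r := (1 + d)^-1.
have d1 : 0 < 1 + d by rewrite addr_gt0.
have r0 : 0 <= r by rewrite invr_ge0 ltW.
have rd : 1 - r < d.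
  rewrite -[1](mulfV (lt0r_neq0 d1)) -/r -[r in X in _ - X]mul1r -mulrBl.
  by rewrite addrC addKr ltr_pdivrMr // ltr_pMr // ltrDl.
(* r z is in the open disc, at distance at most 1 - r = d r from z. *)
exists (r *: z) => /=.
  rewrite normrZ ger0_norm // (@le_lt_trans _ _ r) ?ler_piMr //.
  by rewrite invf_lt1 // ltrDl.
rewrite -{1}[z]scale1r -scalerBl normrZ ger0_norm; last first.
  by rewrite subr_ge0 invf_le1 // lerDl ltW.
by rewrite (le_lt_trans _ rd) // ler_piMr // subr_ge0 invf_le1 // lerDl ltW.
Qed.

(* The family f is indexed by l >= 1 and j >= 0; the values f 0 j are unused.
   R[i]^o is R[i] with the topology given by the modulus. *)
Theorem corollary4p4 (R : realType) (E F : hilbertType R)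
    (e : nat -> E) (f : nat -> nat -> F)
    (he : orthonormal_basis setT e)
    (hf : orthonormal_basis [set p : nat * nat | (1 <= p.1)%N]
            (fun p : nat * nat => f p.1 p.2))
    (T : {linear hsum E F -> hsum E F})
    (hT : bounded_near T (nbhs 0))
    (hTf : forall l j : nat, (1 <= l)%N -> (1 <= j)%N ->
       T (hsumr (f l j)) = hsumr (f l (j - 1)%N))
    (hTf0 : forall l : nat, (1 <= l)%N -> T (hsumr (f l 0%N)) = 0)
    (hTe : forall j : nat, (forall k : nat, (1 <= k)%N -> j <> (3 ^ k)%N) ->
       T (hsuml (e j)) = hsuml (e (j + 1)%N))
    (hTe3 : forall k l : nat, (1 <= k)%N -> (1 <= l)%N ->
       (2 ^ (l - 1) <= k <= 2 ^ l - 1)%N ->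
       T (hsuml (e (3 ^ k)%N)) =
         hsuml (e (3 ^ k + 1)%N) + hsumr (f l (3 ^ k)%N)) :
  let e0 := hsuml (e 0%N) : hsum E F in
  let H0 := cspan_type (forward_orbit T e0) in
  let T0 := restr (cspan_forward_orbit_stable e0 hT) : {linear H0 -> H0} in
  essential_spectrum T0 = closure [set z : R[i]^o | `|z| < 1].
Proof.
move=> e0 H0 T0; rewrite closure_unit_disc; apply/seteqP; split=> lam /=.
  case: (@real_leP R[i] `|lam| 1) => // [|lam1]; first exact: normr_real.
  by move=> /(essential_spectrum_sub_disc he hf hTf hTf0 hTe hTe3 lam1).
exact: (disc_sub_essential_spectrum he hf hTf hTf0 hTe hTe3).
Qed.
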